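(* For every integer $n\ge 0$, the number $N_{ST}(G_n)$ of spanning trees of the Farey graph $G_n$ is $$N_{ST}(G_n)=(2^{n+1}-1)\prod_{i=2}^{n}(2^i-1)^{2^{n-i}},$$ where an empty product equals $1$.
   Context: The Farey graphs $G_n$ ($n\ge 0$), each with two distinguished (''special'') vertices $X_n,Y_n$, are defined recursively. $G_0$ is a single edge joining its two special vertices $X_0$ and $Y_0$. For $n\ge 1$, take two disjoint copies $G_{n-1}^1,G_{n-1}^2$ of $G_{n-1}$, with special vertices $X_{n-1}^i,Y_{n-1}^i$ ($i=1,2$); identify $Y_{n-1}^1$ with $X_{n-1}^2$ into one vertex, and add a new edge $e_n$ joining $X_{n-1}^1$ and $Y_{n-1}^2$. The result is $G_n$, with special vertices $X_n=X_{n-1}^1$ and $Y_n=Y_{n-1}^2$. It has $2^n+1$ vertices and $2^{n+1}-1$ edges. *)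

(* Defs.v *)
From mathcomp Require Import all_boot.

Set Implicit Arguments.
Unset Strict Implicit.
Unset Printing Implicit Defensive.

(* A finite simple graph is given by its finType V of vertices and its set E  *)
(* of edges, each edge being an unordered pair [set x; y] with x != y.        *)
Section SpanningTrees.

Variable V : finType.
Implicit Types (E F : {set {set V}}).

Definition simple_graph E := [forall e in E, #|e| == 2].

Definition adj E : rel V := fun x y => [set x; y] \in E.

Definition connected_graph E := [forall x, forall y, connect (adj E) x y].

(* No simple closed walk of length at least 3. Such a walk visits each vertex *)
(* at most once, so bounding its length by #|V| loses nothing, and makes the  *)
(* predicate boolean.                                                         *)
Definition acyclic_graph E :=
  [forall k : 'I_#|V|.+1, forall c : k.-tuple V,
     (2 < k) ==> ~~ ucycleb (adj E) c].

Definition tree_graph E := connected_graph E && acyclic_graph E.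

(* The vertex set of a spanning tree is all of V. *)
Definition spanning_tree E F := (F \subset E) && tree_graph F.

Definition num_spanning_trees E := #|[set F | spanning_tree E F]|.

End SpanningTrees.

Record special_graph := SpecialGraph {
  vertex : finType;
  edges : {set {set vertex}};
  spX : vertex;
  spY : vertex
}.

Section Gluing.

Variable G : special_graph.
Local Notation V := (vertex G).

(* Two disjoint copies of V, with the vertex Y of the first identified with   *)
(* the vertex X of the second: the second copy of X is removed from V + V,    *)
(* and copy2 sends X to the first copy of Y.                                  *)
Definition glue_vertex : finType := (V + {v : V | v != spX G})%type.

Definition copy1 (v : V) : glue_vertex := inl v.

Definition copy2 (v : V) : glue_vertex :=
  if insub v is Some u then inr u else inl (spY G).

Definition glue_edges : {set {set glue_vertex}} :=
  [set [set copy1 (spX G); copy2 (spY G)]]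
    :|: [set copy1 @: e | e : {set V} in edges G]
    :|: [set copy2 @: e | e : {set V} in edges G].

Definition glue : special_graph :=
  SpecialGraph glue_edges (copy1 (spX G)) (copy2 (spY G)).

End Gluing.

Definition single_edge : special_graph :=
  @SpecialGraph bool [set [set false; true]] false true.

Fixpoint farey (n : nat) : special_graph :=
  if n is m.+1 then glue (farey m) else single_edge.

Section GluingTheory.

Variable G : special_graph.
Hypothesis XY : spX G != spY G.
Hypothesis sG : simple_graph (edges G).

Lemma copy1_inj : injective (@copy1 G).
Proof. by move=> u v []. Qed.

Lemma copy2_inj : injective (@copy2 G).
Proof.
move=> u v; rewrite /copy2.
case: insubP => [u' _ <-|]; case: insubP => [v' _ <-|] //.
- by move=> [->].
- by rewrite !negbK => /eqP-> /eqP->.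
Qed.

Lemma copy2X : copy2 (spX G) = copy1 (spY G).
Proof. by rewrite /copy2 insubF ?eqxx. Qed.

Lemma copy12_eq u v : copy1 u = copy2 v :> glue_vertex G ->
  u = spY G /\ v = spX G.
Proof.
by rewrite /copy2; case: insubP => // /negbNE/eqP-> [->].
Qed.

Lemma glue_special_neq : spX (glue G) != spY (glue G).
Proof. by apply: contra_neq XY => /copy12_eq[]. Qed.

Lemma simple_glue : simple_graph (edges (glue G)).
Proof.
apply/'forall_implyP => e; rewrite !inE -orbA => /or3P[/eqP->|/imsetP[f fE ->]|/imsetP[f fE ->]].
- by rewrite cards2 glue_special_neq.
- by rewrite card_imset; [exact: (implyP (forallP sG f)) | exact: copy1_inj].
- by rewrite card_imset; [exact: (implyP (forallP sG f)) | exact: copy2_inj].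
Qed.

Lemma card_glue_vertex : #|vertex (glue G)| = #|vertex G|.*2.-1.
Proof.
rewrite card_sum card_sig -addnn.
have /= := cardC (pred1 (spX G)); rewrite card1 => <-.
by rewrite addnA addn1 /= addnC.
Qed.

Lemma card_glue_edges : #|edges (glue G)| = #|edges G|.*2.+1.
Proof.
have c2 (e : {set vertex G}) : e \in edges G -> #|e| = 2.
  by move=> eE; apply/eqP/(implyP (forallP sG e)).
have A (e : {set vertex G}) : e \in edges G ->
    [set copy1 (spX G); copy2 (spY G)] <> [set copy1 x | x in e].
  move=> _ E; have : copy2 (spY G) \in [set copy1 x | x in e].
    by rewrite -E !inE eqxx orbT.
  by case/imsetP=> x _ /esym/copy12_eq[_ H]; move: XY; rewrite H eqxx.
have B (e : {set vertex G}) : e \in edges G ->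
    [set copy1 (spX G); copy2 (spY G)] <> [set copy2 x | x in e].
  move=> _ E; have : copy1 (spX G) \in [set copy2 x | x in e].
    by rewrite -E !inE eqxx.
  by case/imsetP=> x _ /copy12_eq[H _]; move: XY; rewrite H eqxx.
have C (e f : {set vertex G}) : e \in edges G -> f \in edges G ->
    [set copy1 x | x in e] <> [set copy2 x | x in f].
  move=> eE fE E; have: e \subset [set spY G].
    apply/subsetP => x xe; have : copy1 x \in [set copy2 x | x in f].
      by rewrite -E imset_f.
    by case/imsetP=> y _ /copy12_eq[-> _]; rewrite inE.
  by move/subset_leq_card; rewrite c2 // cards1.
rewrite /= /glue_edges -setUA cardsU1 cardsU.
rewrite !card_imset; last 2 first.
- exact/imset_inj/copy2_inj.
- exact/imset_inj/copy1_inj.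
rewrite [_ :&: _](_ : _ = set0) ?cards0 ?subn0 ?addnn.
  rewrite (_ : _ \notin _) //; rewrite inE negb_or.
  by apply/andP; split; apply/imsetP => -[e eE]; [exact: A | exact: B].
apply/setP => h; rewrite !inE; apply/andP => -[/imsetP[e eE ->] /imsetP[f fE]].
exact: C.
Qed.

End GluingTheory.

Lemma farey_simple n :
  spX (farey n) != spY (farey n) /\ simple_graph (edges (farey n)).
Proof.
elim: n => [|n [XY sG]]; last by split; [exact: glue_special_neq|exact: simple_glue].
split=> //; apply/forallP => e; apply/implyP; rewrite inE => /eqP->.
by rewrite cards2.
Qed.

Lemma card_farey_vertex n : #|vertex (farey n)| = 2 ^ n + 1.
Proof.
elim: n => [|n IHn]; first by rewrite card_bool.
by rewrite card_glue_vertex IHn expnS mul2n addn1 doubleS addn1.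
Qed.

Lemma card_farey_edges n : #|edges (farey n)| = 2 ^ n.+1 - 1.
Proof.
elim: n => [|n IHn]; first by rewrite cards1.
have [XY sG] := farey_simple n.
rewrite card_glue_edges // IHn [in RHS]expnS mul2n.
by case: (2 ^ n.+1) (expn_gt0 2 n.+1) => // k _; rewrite !subn1.
Qed.

(* Main.v *)
Require Import Defs.
From mathcomp Require Import all_boot.

(** Count together the spanning trees of [G_n] ([a_n] of them) and the spanning
forests with exactly two components, one containing [X_n] and the other [Y_n]
([b_n] of them).  In the one-point union of two copies of [G_n], a spanning
tree is a pair of spanning trees and a separating forest is a spanning tree on
one side and a separating forest on the other; and adding the edge [e_(n+1)]
turns separating forests into spanning trees.  Hence
[a_(n+1) = a_n ^ 2 + 2 * a_n * b_n] and [b_(n+1) = 2 * a_n * b_n], whose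
solution is [b_n = 2 ^ n * P_n], [a_n = (2 ^ (n+1) - 1) * P_n], where the
product [P_n] satisfies [P_(n+1) = (2 ^ (n+1) - 1) * P_n ^ 2].  Acyclicity is
handled in the form "every edge is a bridge", since only connectedness then has
to be analysed in a union. *)

Set Implicit Arguments.
Unset Strict Implicit.
Unset Printing Implicit Defensive.

(** * Reachability, bridges and acyclicity in an edge set *)

Local Notation conn F := (connect (adj F)).

(** Images of adjacent vertices need only be connected, not adjacent, so that maps collapsing edges
    to a point are covered. *)
Lemma connect_homo (T T' : finType) (e : rel T) (e' : rel T') (f : T -> T') :
    (forall x y, e x y -> connect e' (f x) (f y)) ->
  forall x y, connect e x y -> connect e' (f x) (f y).
Proof.
move=> ef x y /connectP[p]; elim: p x => [x _ -> //|z p IHp x /=].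
by move=> /andP[/ef exz pz] yE; apply: connect_trans exz (IHp _ pz yE).
Qed.

Lemma set2_eq (T : finType) (u w x y : T) :
  [set u; w] = [set x; y] -> u = x /\ w = y \/ u = y /\ w = x.
Proof.
move=> E; have := set21 u w; have := set22 u w; rewrite {1 2}E => wE uE.
have := set21 x y; have := set22 x y; rewrite -E.
by move: uE wE; do 4![case/set2P => ?]; subst; auto.
Qed.

Section Forests.

Variable V : finType.
Implicit Types (E F : {set {set V}}) (x y u v : V).

Lemma conn_sym F : connect_sym (adj F).
Proof. by apply: sym_connect_sym => x y; rewrite /adj setUC. Qed.

Lemma conn_sub F F' x y : F \subset F' -> conn F x y -> conn F' x y.
Proof.
move=> /subsetP sFF'; apply: connect_sub => u v uv; apply: connect1.
exact: sFF'.
Qed.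

(** A walk never needs the new edge more than once: the three cases are no crossing, a crossing from
    [x] to [y], and a crossing from [y] to [x]. *)
Lemma conn_setU1 F x y u v :
  conn ([set x; y] |: F) u v =
    [|| conn F u v, conn F u x && conn F y v | conn F u y && conn F x v].
Proof.
apply/idP/idP => [/connectP[p]|].
  elim: p u => [u _ ->|w p IHp u /= /andP[uw /IHp/[apply]]].
    by rewrite connect0.
  move: uw; rewrite /adj !inE => /orP[/eqP uwE|uwF];
    last have uw : conn F u w by apply: connect1.
    case/set2_eq: uwE => -[-> ->]; rewrite !connect0 /=.
      by case/or3P => [->|/andP[_ ->]|->]; rewrite ?orbT.
    by case/or3P => [->|->|/andP[_ ->]]; rewrite ?orbT.
  case/or3P => [wv|/andP[wx ->]|/andP[wy ->]].
  - by rewrite (connect_trans uw wv).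
  - by rewrite (connect_trans uw wx) orbT.
  - by rewrite (connect_trans uw wy) !orbT.
have sF : F \subset [set x; y] |: F by apply: subsetUr.
have xy : conn ([set x; y] |: F) x y.
  by apply: connect1; rewrite /adj setU11.
case/or3P => [|/andP[ux yv]|/andP[uy xv]]; first exact: conn_sub.
  apply: connect_trans (conn_sub sF yv).
  exact: connect_trans (conn_sub sF ux) xy.
apply: connect_trans (conn_sub sF xv).
by apply: connect_trans (conn_sub sF uy) _; rewrite conn_sym.
Qed.

(** The condition [x != y] leaves singleton members of [F] unconstrained, in agreement with
    [acyclic_graph], whose cycles have at least three distinct vertices. *)
Definition all_bridges F :=
  [forall x, forall y, (x != y) && ([set x; y] \in F) ==>
     ~~ conn (F :\ [set x; y]) x y].

Lemma all_bridgesP F :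
  reflect (forall x y, x != y -> [set x; y] \in F ->
             ~~ conn (F :\ [set x; y]) x y)
          (all_bridges F).
Proof.
apply: (iffP forallP) => [bF x y xy xyF|bF x].
  by have /forallP/(_ y)/implyP := bF x; apply; rewrite xy.
by apply/forallP => y; apply/implyP => /andP[]; apply: bF.
Qed.

(** A simple path joining the ends of an edge without using it closes up to a cycle; conversely, the
    first edge of a cycle is bypassed by the rest of the cycle. *)
Lemma acyclicE F : acyclic_graph F = all_bridges F.
Proof.
apply/forallP/all_bridgesP => [aF x y xy xyF|bF k].
  apply/negP => /connectP[p0 p0P yE]; case/shortenP: p0P yE => p pP up _ yE.
  (* A path of length 0 would give [x = y], and one of length 1 would be the deleted edge. *)
  have p_gt1 : 1 < size p.
    case: p pP {up} yE => [|z [|? ?]] //=.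
      by move=> _ /eqP; rewrite eq_sym (negPf xy).
    by rewrite /adj !inE => /andP[/andP[+ _] _] zE; rewrite -zE eqxx.
  have sp : size (x :: p) < #|V|.+1.
    by rewrite ltnS -(card_uniqP up) max_card.
  have /forallP/(_ (in_tuple (x :: p))) := aF (Ordinal sp).
  rewrite /= ltnS p_gt1 /= /ucycleb up andbT /= rcons_path -yE.
  rewrite {2}/adj setUC xyF andbT => /negP; apply.
  by apply: sub_path pP => a b; rewrite /adj inE => /andP[].
apply/forallP => -[c /= /eqP sc]; apply/implyP; rewrite -sc => c_gt2.
apply/negP => /andP[].
case: c c_gt2 {sc} => [//|x [//|y p]] p_gt0.
rewrite (cycle_path x) /= => /and3P[zx xy yp] /and3P[].
rewrite inE negb_or => /andP[nxy xp] yNp up.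
have /negP := bF _ _ nxy xy; apply.
(* The rest of the cycle runs from [y] through [p] back to [x]. Its closing edge is not
   [[set x; y]], because [p] is nonempty and avoids [y]. *)
rewrite conn_sym; apply/connectP; exists (rcons p x); last first.
  by rewrite last_rcons.
rewrite rcons_path; apply/andP; split; last first.
  rewrite /adj !inE; apply/andP; split=> //.
  case: p p_gt0 {zx yp xp up} yNp => //= z p _ yNp.
  apply/eqP => /setP/(_ y); rewrite !inE eqxx orbT.
  rewrite [y == x]eq_sym (negPf nxy) orbF => /eqP yE.
  by move: yNp; rewrite yE mem_last.
(* The remaining edges do not contain [x], so they survive the deletion of [[set x; y]]. *)
have sub : {in predC1 x &, forall a b, adj F a b -> adj (F :\ [set x; y]) a b}.
  move=> a b; rewrite !inE => ax bx ab.
  rewrite /adj !inE; apply/andP; split=> //.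
  apply/eqP => /setP/(_ x); rewrite !inE eqxx /= ![x == _]eq_sym.
  by rewrite (negPf ax) (negPf bx).
apply: (sub_in_path sub) yp; rewrite /= eq_sym nxy /=.
by apply/allP => z zp /=; apply: contraNneq xp => <-.
Qed.

(** If an old bridge [[set u; v]] stopped being one, the detour around it would cross the new edge;
    its two remaining pieces, joined by [[set u; v]] itself, would connect [x] to [y] in [F]. *)
Lemma all_bridges_setU1 F x y : x != y -> [set x; y] \notin F ->
  all_bridges ([set x; y] |: F) = all_bridges F && ~~ conn F x y.
Proof.
move=> xy xyF; apply/all_bridgesP/andP => [bF|[/all_bridgesP bF nxy] u v uv].
  split; last by have := bF x y xy (setU11 _ _); rewrite setU1K.
  apply/all_bridgesP => u v uv uvF; have := bF u v uv (setU1r _ uvF).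
  by apply: contra; apply: conn_sub; apply/setSD/subsetUr.
have [E _|uvxy] := eqVneq [set u; v] [set x; y].
  rewrite E setU1K //; case/set2_eq: E => -[-> ->] //.
  by rewrite conn_sym.
rewrite !inE (negPf uvxy) /= => uvF.
have -> : ([set x; y] |: F) :\ [set u; v] = [set x; y] |: (F :\ [set u; v]).
  rewrite setDUl; congr (_ :|: _); apply/setDidPl.
  by rewrite disjoints1 inE eq_sym.
have cuv : conn F u v by apply: connect1.
have sD a b : conn (F :\ [set u; v]) a b -> conn F a b.
  by apply: conn_sub; apply: subsetDl.
rewrite conn_setU1 (negPf (bF _ _ uv uvF)) /=; apply: contra nxy.
case/orP => /andP[/sD ux /sD yv].
  rewrite conn_sym in ux; apply: connect_trans ux (connect_trans cuv _).
  by rewrite conn_sym.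
by rewrite conn_sym in cuv; apply: connect_trans yv (connect_trans cuv ux).
Qed.

Lemma connected_via F x :
  connected_graph F = [forall v, conn F x v].
Proof.
apply/forallP/forallP => [cF v|cF u]; first exact: forallP (cF x) v.
apply/forallP => v; apply: connect_trans (cF v).
by rewrite conn_sym.
Qed.

(** * Separating forests, and the effect of adding an edge *)

Definition two_components F x y :=
  ~~ conn F x y && [forall v, conn F x v || conn F y v].

Definition num_separating_forests E x y :=
  #|[set F : {set {set V}} |
      (F \subset E) && (all_bridges F && two_components F x y)]|.

Lemma num_spanning_treesE E :
  num_spanning_trees E =
    #|[set F : {set {set V}} |
        (F \subset E) && (all_bridges F && connected_graph F)]|.
Proof.
apply: eq_card => F; rewrite !inE /spanning_tree /tree_graph acyclicE.
by rewrite [all_bridges F && _]andbC.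
Qed.

Lemma connected_setU1 F x y :
  ~~ conn F x y ->
  connected_graph ([set x; y] |: F) = [forall v, conn F x v || conn F y v].
Proof.
move=> nxy; rewrite (connected_via _ x); apply: eq_forallb => v.
by rewrite conn_setU1 connect0 (negPf nxy) /= orbF.
Qed.

(** Trees avoiding the new edge are the spanning trees of [E]; deleting the edge from the others
    gives a bijection with the forests separating [x] from [y]. *)
Lemma num_spanning_trees_setU1 E x y : x != y -> [set x; y] \notin E ->
  num_spanning_trees ([set x; y] |: E) =
    num_spanning_trees E + num_separating_forests E x y.
Proof.
move=> xy xyE; rewrite !num_spanning_treesE.
rewrite -[LHS](cardsID [set F : {set {set V}} | [set x; y] \notin F]).
congr (_ + _).
  apply: eq_card => F; rewrite !inE andbC; apply/andP/andP.
    by move=> [xyF /andP[sF ->]]; rewrite -(setU1K xyE) subsetD1 sF xyF.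
  move=> [sF ->]; rewrite andbT (contra (subsetP sF _) xyE).
  by rewrite (subset_trans sF) ?subsetUr.
pose A := [set F : {set {set V}} |
  (F \subset E) && (all_bridges F && two_components F x y)].
have AP F : F \in A -> [set x; y] \notin F.
  by rewrite inE => /andP[sF _]; apply: contra xyE; apply: (subsetP sF).
have U1I : {in A &, injective (setU [set [set x; y]])}.
  by move=> F F' /AP FA /AP F'A E'; rewrite -(setU1K FA) E' setU1K.
rewrite [RHS](_ : _ = #|A|) // -(card_in_imset U1I).
apply: eq_card => F; apply/idP/imsetP.
  rewrite !inE negbK => /andP[xyF /andP[sF /andP[bF cF]]].
  have FK := setD1K xyF; exists (F :\ [set x; y]) => //.
  have xyF' : [set x; y] \notin F :\ [set x; y] by rewrite setD11.
  move: bF cF; rewrite -{1 2}FK all_bridges_setU1 // => /andP[bF nxy].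
  rewrite connected_setU1 // => cF.
  by rewrite inE /two_components bF nxy cF !andbT subDset.
move=> [F' /[dup]/AP xyF']; rewrite inE => /and4P[sF' bF' nxy cF'] ->.
rewrite !inE eqxx /= setUS // all_bridges_setU1 // connected_setU1 //.
by rewrite bF' nxy.
Qed.

(** A forest that contains the new edge connects [x] to [y], so it is not counted. *)
Lemma num_separating_forests_setU1 E x y : x != y -> [set x; y] \notin E ->
  num_separating_forests ([set x; y] |: E) x y = num_separating_forests E x y.
Proof.
move=> xy xyE; apply: eq_card => F; rewrite !inE; apply/andP/andP.
  move=> [sF /andP[-> tF]]; rewrite tF -(setU1K xyE) subsetD1 sF.
  split=> //=; move: tF; apply: contraL => xyF.
  by rewrite negb_and negbK connect1.
by move=> [sF ->]; rewrite (subset_trans sF) ?subsetUr.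
Qed.

End Forests.

(** * Connectivity and bridges in a one-point union *)

Section OnePointUnion.

Variables (V1 V2 W : finType) (f1 : V1 -> W) (f2 : V2 -> W) (p1 : V1) (p2 : V2).

(** Stated through two embeddings rather than a concrete quotient, so that the two parts play
    symmetric roles and each one-sided fact transfers to the other part. *)
Definition one_point_gluing :=
  [/\ injective f1, injective f2, f1 p1 = f2 p2,
      forall u v, f1 u = f2 v -> u = p1 /\ v = p2
    & forall w, (exists u, w = f1 u) \/ (exists v, w = f2 v)].

Definition edge_union (F1 : {set {set V1}}) (F2 : {set {set V2}}) :
    {set {set W}} :=
  [set f1 @: (e : {set V1}) | e in F1] :|: [set f2 @: (e : {set V2}) | e in F2].

End OnePointUnion.

Lemma one_point_gluing_sym (V1 V2 W : finType) (f1 : V1 -> W) (f2 : V2 -> W)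
    (p1 : V1) (p2 : V2) :
  one_point_gluing f1 f2 p1 p2 -> one_point_gluing f2 f1 p2 p1.
Proof.
case=> f1I f2I p12 f12 cov; split=> // [u v /esym/f12[]//|w].
by case: (cov w); [right | left].
Qed.

Lemma edge_unionC (V1 V2 W : finType) (f1 : V1 -> W) (f2 : V2 -> W) F1 F2 :
  edge_union f1 f2 F1 F2 = edge_union f2 f1 F2 F1.
Proof. exact: setUC. Qed.

Lemma imset_set2 (T T' : finType) (f : T -> T') x y :
  f @: [set x; y] = [set f x; f y].
Proof. by rewrite imsetU1 imset_set1. Qed.

Lemma imset_eq_set2 (T T' : finType) (f : T -> T') (e : {set T}) x y :
    injective f -> [set x; y] = f @: e ->
  exists u v, [/\ x = f u, y = f v & e = [set u; v]].
Proof.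
move=> fI xyE.
have /imsetP[u _ xE] : x \in f @: e by rewrite -xyE set21.
have /imsetP[v _ yE] : y \in f @: e by rewrite -xyE set22.
exists u, v; split=> //; apply: (imset_inj fI).
by rewrite imset_set2 -xE -yE.
Qed.

Lemma imsetD1_inj (T T' : finType) (f : T -> T') (A : {set T}) x :
  injective f -> f @: (A :\ x) = f @: A :\ f x.
Proof.
move=> fI; apply/setP => y; rewrite !inE; apply/imsetP/andP.
  by move=> [z /setD1P[zx zA] ->]; rewrite (inj_eq fI) zx imset_f.
move=> [yx /imsetP[z zA yE]]; exists z => //; rewrite !inE zA andbT.
by apply: contraNneq yx => <-; rewrite yE.
Qed.

Section Retract.

Variables (V1 V2 W : finType) (f1 : V1 -> W) (f2 : V2 -> W) (p1 : V1) (p2 : V2).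
Hypothesis f12P : one_point_gluing f1 f2 p1 p2.
Local Notation joined := (edge_union f1 f2).

(* Collapses the second part of the union to the gluing point. *)
Let retract (w : W) : V1 := odflt p1 [pick u | f1 u == w].

Let retract1 u : retract (f1 u) = u.
Proof.
case: f12P => f1I _ _ _ _; rewrite /retract.
by case: pickP => [v /eqP/f1I //|/(_ u)]; rewrite eqxx.
Qed.

Let retract2 v : retract (f2 v) = p1.
Proof.
case: f12P => _ _ _ f12 _; rewrite /retract.
by case: pickP => //= u /eqP/f12[].
Qed.

(** The retraction keeps each edge of the first part and collapses each edge of the second, so walks
    in the union project to walks in [F1]. *)
Let conn_retract F1 F2 x y :
  conn (joined F1 F2) x y -> conn F1 (retract x) (retract y).
Proof.
case: f12P => f1I f2I _ _ _; apply: connect_homo => {}x {}y.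
rewrite /adj inE => /orP[]/imsetP[e eF].
  move=> /(imset_eq_set2 f1I)[u [v [-> -> eE]]].
  by rewrite !retract1; apply: connect1; rewrite /adj -eE.
by move=> /(imset_eq_set2 f2I)[u [v [-> -> _]]]; rewrite !retract2.
Qed.

Lemma conn_edge_union1 F1 F2 u v :
  conn (joined F1 F2) (f1 u) (f1 v) = conn F1 u v.
Proof.
apply/idP/idP => [/conn_retract|]; first by rewrite !retract1.
apply: connect_homo => {}u {}v uv; apply: connect1.
by rewrite /adj -imset_set2 inE imset_f.
Qed.

Lemma conn_edge_union_gluing F1 F2 u v :
  conn (joined F1 F2) (f1 u) (f2 v) -> conn F1 u p1.
Proof. by move/conn_retract; rewrite retract1 retract2. Qed.

(** The two parts share a single vertex, too few to hold an edge. *)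
Lemma imset_neq (e1 : {set V1}) (e2 : {set V2}) :
  #|e1| = 2 -> f1 @: e1 <> f2 @: e2.
Proof.
case: f12P => _ _ _ f12 _ e1_2 e12.
suff /subset_leq_card : e1 \subset [set p1] by rewrite e1_2 cards1.
apply/subsetP => u ue; have : f1 u \in f2 @: e2 by rewrite -e12 imset_f.
by case/imsetP => v _ /f12[-> _]; rewrite set11.
Qed.

Lemma edge_union_rem F1 F2 (e : {set V1}) : #|e| = 2 ->
  joined F1 F2 :\ f1 @: e = joined (F1 :\ e) F2.
Proof.
case: f12P => f1I _ _ _ _ e2; rewrite /edge_union setDUl.
rewrite (imsetD1_inj _ _ (imset_inj f1I)); congr (_ :|: _).
apply/setDidPl; rewrite disjoint_sym disjoints1; apply/imsetP => -[e' _].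
exact: imset_neq.
Qed.

Lemma mem_edge_union F1 F2 (e : {set V1}) : #|e| = 2 ->
  (f1 @: e \in joined F1 F2) = (e \in F1).
Proof.
case: f12P => f1I _ _ _ _ e2; rewrite inE mem_imset; last exact: imset_inj.
by apply/orb_idr => /imsetP[e' _ /imset_neq].
Qed.

Lemma bridge_edge_union F1 F2 u v : u != v ->
  conn (joined F1 F2 :\ [set f1 u; f1 v]) (f1 u) (f1 v) =
    conn (F1 :\ [set u; v]) u v.
Proof.
move=> uv; rewrite -imset_set2 edge_union_rem ?cards2 ?uv //.
by rewrite conn_edge_union1.
Qed.

Lemma all_bridges_edge_union1 F1 F2 :
  all_bridges (joined F1 F2) -> all_bridges F1.
Proof.
case: f12P => f1I _ _ _ _ /all_bridgesP bF; apply/all_bridgesP => u v uv uvF.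
rewrite -(bridge_edge_union _ F2) //; apply: bF; first by rewrite (inj_eq f1I).
by rewrite -imset_set2 inE imset_f.
Qed.

(** Simplicity of [E1] matters here: the singletons of the two gluing points have the same image, so
    only two-element sets can be traced back to their part. *)
Lemma edge_union_recover1 (E1 F1 F1' : {set {set V1}}) F2 F2' :
    simple_graph E1 -> F1 \subset E1 -> F1' \subset E1 ->
  joined F1 F2 = joined F1' F2' -> F1 = F1'.
Proof.
move=> /'forall_implyP sE /subsetP sF /subsetP sF' eqF; apply/setP => e.
have [/eqP e2|eN2] := boolP (#|e| == 2).
  by rewrite -(mem_edge_union F1 F2 e2) eqF mem_edge_union.
have eE : e \notin E1 by apply: contra eN2; apply: sE.
by rewrite (negPf (contra (sF e) eE)) (negPf (contra (sF' e) eE)).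
Qed.

End Retract.

Section OnePointUnionTheory.

Variables (V1 V2 W : finType) (f1 : V1 -> W) (f2 : V2 -> W) (p1 : V1) (p2 : V2).
Hypothesis f12P : one_point_gluing f1 f2 p1 p2.
Let f21P := one_point_gluing_sym f12P.
Local Notation joined := (edge_union f1 f2).

Lemma conn_edge_union2 F1 F2 u v :
  conn (joined F1 F2) (f2 u) (f2 v) = conn F2 u v.
Proof. by rewrite edge_unionC (conn_edge_union1 f21P). Qed.

Lemma conn_edge_union12 F1 F2 u v :
  conn (joined F1 F2) (f1 u) (f2 v) = conn F1 u p1 && conn F2 p2 v.
Proof.
apply/idP/andP => [uv|[up pv]].
  split; first exact: (conn_edge_union_gluing f12P) uv.
  move: uv; rewrite conn_sym edge_unionC [conn _ p2 _]conn_sym.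
  exact: (conn_edge_union_gluing f21P).
apply: (@connect_trans _ _ (f1 p1)); first by rewrite (conn_edge_union1 f12P).
by case: f12P => _ _ -> _ _; rewrite conn_edge_union2.
Qed.

Lemma all_bridges_edge_union F1 F2 :
  all_bridges (joined F1 F2) = all_bridges F1 && all_bridges F2.
Proof.
have [f1I f2I _ _ _] := f12P; apply/idP/andP => [bF|[]].
  split; first exact: (all_bridges_edge_union1 f12P) bF.
  by move: bF; rewrite edge_unionC => /(all_bridges_edge_union1 f21P).
move=> /all_bridgesP b1 /all_bridgesP b2; apply/all_bridgesP => x y xy.
rewrite inE => /orP[]/imsetP[e eF].
  move/(imset_eq_set2 f1I) => [u [v [xE yE eE]]]; subst.
  have uv : u != v by apply: contraNneq xy => ->.
  by rewrite (bridge_edge_union f12P) // b1.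
move/(imset_eq_set2 f2I) => [u [v [xE yE eE]]]; subst.
have uv : u != v by apply: contraNneq xy => ->.
by rewrite edge_unionC (bridge_edge_union f21P) // b2.
Qed.

Lemma connected_edge_union F1 F2 :
  connected_graph (joined F1 F2) = connected_graph F1 && connected_graph F2.
Proof.
have [_ _ p12 _ cov] := f12P.
(* All three graphs are explored from the gluing point. *)
rewrite !(connected_via _ (f1 p1), connected_via _ p1, connected_via _ p2).
apply/forallP/andP => [cF|[/forallP c1 /forallP c2] w].
  split; apply/forallP => v.
    by have := cF (f1 v); rewrite (conn_edge_union1 f12P).
  by have := cF (f2 v); rewrite p12 conn_edge_union2.
case: (cov w) => -[v ->]; first by rewrite (conn_edge_union1 f12P).
by rewrite p12 conn_edge_union2.
Qed.

Lemma two_components_edge_union_conn F1 F2 s t :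
    two_components (joined F1 F2) (f1 s) (f2 t) -> conn F1 s p1 ->
  connected_graph F1 && two_components F2 p2 t.
Proof.
have [_ _ p12 _ _] := f12P.
rewrite /two_components conn_edge_union12 => /andP[+ /forallP cF] sp.
rewrite sp /= => npt; rewrite npt /= (connected_via _ s).
apply/andP; split; apply/forallP => v.
  (* A vertex of the first part in the component of [t] would be reached through the gluing point,
     connecting [p2] to [t]. *)
  have /orP[|] := cF (f1 v); first by rewrite (conn_edge_union1 f12P).
  rewrite conn_sym conn_edge_union12 => /andP[_ pt].
  by rewrite pt in npt.
by have := cF (f2 v); rewrite conn_edge_union12 sp conn_edge_union2.
Qed.

Lemma edge_union_two_components F1 F2 s t :
    connected_graph F1 -> two_components F2 p2 t ->
  two_components (joined F1 F2) (f1 s) (f2 t).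
Proof.
have [_ _ _ _ cov] := f12P.
move=> /forallP c1 /andP[npt /forallP c2].
have c1' u v : conn F1 u v by have /forallP := c1 u; apply.
rewrite /two_components conn_edge_union12 c1' npt; apply/forallP => w.
case: (cov w) => -[v ->]; first by rewrite (conn_edge_union1 f12P) c1'.
by rewrite conn_edge_union12 c1' conn_edge_union2 /=.
Qed.

End OnePointUnionTheory.

Lemma two_componentsC (V : finType) (F : {set {set V}}) x y :
  two_components F x y = two_components F y x.
Proof.
rewrite /two_components conn_sym; congr (_ && _).
by apply: eq_forallb => v; rewrite orbC.
Qed.

(** * Counting trees and separating forests in a one-point union *)

Section Counting.

Variables (V1 V2 W : finType) (f1 : V1 -> W) (f2 : V2 -> W) (p1 : V1) (p2 : V2).
Hypothesis f12P : one_point_gluing f1 f2 p1 p2.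
Let f21P := one_point_gluing_sym f12P.
Local Notation joined := (edge_union f1 f2).

(** The gluing point lies in the component of [s] or in that of [t]; the part on that side is
    connected, and the other part carries the separation. *)
Lemma two_components_edge_union F1 F2 s t :
  two_components (joined F1 F2) (f1 s) (f2 t) =
    (connected_graph F1 && two_components F2 p2 t)
      || (two_components F1 s p1 && connected_graph F2).
Proof.
apply/idP/orP => [tF|[/andP[c1 t2]|/andP[t1 c2]]].
- have [sp|nsp] := boolP (conn F1 s p1).
    by left; apply: (two_components_edge_union_conn f12P) tF sp.
  (* This is the previous case with the parts and the endpoints exchanged. *)
  right; rewrite andbC two_componentsC.
  apply: (two_components_edge_union_conn f21P).
    by rewrite -edge_unionC two_componentsC; apply: tF.
  have [_ _ p12 _ _] := f12P.
  have /andP[_ /forallP/(_ (f1 p1))] := tF.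
  by rewrite (conn_edge_union1 f12P) (negPf nsp) p12 (conn_edge_union2 f12P).
- exact: (edge_union_two_components f12P).
- rewrite two_componentsC edge_unionC.
  by apply: (edge_union_two_components f21P); rewrite // two_componentsC.
Qed.

Variables (E1 : {set {set V1}}) (E2 : {set {set V2}}).
Hypotheses (sE1 : simple_graph E1) (sE2 : simple_graph E2).

(** Each subset of the union splits uniquely into a subset of [E1] and a subset of [E2], so counting
    sets of edges becomes counting pairs. *)
Lemma card_subsets_edge_union (P : pred {set {set W}}) :
  #|[set F : {set {set W}} | (F \subset joined E1 E2) && P F]| =
    #|[set q : {set {set V1}} * {set {set V2}} |
        [&& q.1 \subset E1, q.2 \subset E2 & P (joined q.1 q.2)]]|.
Proof.
set A := [set q : {set {set V1}} * {set {set V2}} | _].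
have UI : {in A &, injective (fun q => joined q.1 q.2)}.
  move=> [F1 F2] [F1' F2']; rewrite !inE /=.
  move=> /and3P[sF1 sF2 _] /and3P[sF1' sF2' _] eqF; congr pair.
    exact: (edge_union_recover1 f12P sE1 sF1 sF1' eqF).
  apply: (edge_union_recover1 f21P sE2 sF2 sF2' (F2 := F1) (F2' := F1')).
  by rewrite !(edge_unionC f2 f1).
rewrite -(card_in_imset UI); apply: eq_card => F; rewrite inE.
apply/andP/imsetP => [[sF PF]|[[F1 F2]]]; last first.
  rewrite inE /= => /and3P[sF1 sF2 PF] ->; split=> //.
  by rewrite setUSS ?imsetS.
have FE : F = joined [set e in E1 | f1 @: (e : {set V1}) \in F]
                     [set e in E2 | f2 @: (e : {set V2}) \in F].
  apply/setP => e; rewrite inE; apply/idP/orP.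
    move=> eF; have := subsetP sF e eF; rewrite inE => /orP[]/imsetP[e' e'E eE].
      by left; apply/imsetP; exists e' => //; rewrite inE e'E -eE.
    by right; apply/imsetP; exists e' => //; rewrite inE e'E -eE.
  by case=> /imsetP[e']; rewrite inE => /andP[_ eF] ->.
exists ([set e in E1 | f1 @: (e : {set V1}) \in F],
        [set e in E2 | f2 @: (e : {set V2}) \in F]) => //=.
rewrite inE /= -FE PF andbT; apply/andP.
by split; apply/subsetP => e; rewrite inE => /andP[].
Qed.

Lemma num_spanning_trees_edge_union :
  num_spanning_trees (joined E1 E2) =
    num_spanning_trees E1 * num_spanning_trees E2.
Proof.
rewrite !num_spanning_treesE card_subsets_edge_union -cardsX.
apply: eq_card => -[F1 F2]; rewrite !inE /= (all_bridges_edge_union f12P).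
rewrite (connected_edge_union f12P).
by do !case: (_ \subset _); do !case: (all_bridges _); rewrite //= andbF.
Qed.

Lemma num_separating_forests_edge_union s t :
  num_separating_forests (joined E1 E2) (f1 s) (f2 t) =
    num_spanning_trees E1 * num_separating_forests E2 p2 t +
    num_separating_forests E1 s p1 * num_spanning_trees E2.
Proof.
rewrite !num_spanning_treesE /num_separating_forests card_subsets_edge_union.
(* The two products count disjoint families: a connected [F1] cannot separate [s] from [p1]. *)
rewrite -!cardsX -cardsUI [X in _ = _ + #|_ X|](_ : _ = set0) ?cards0 ?addn0.
  apply: eq_card => -[F1 F2]; rewrite !inE /= (all_bridges_edge_union f12P).
  rewrite two_components_edge_union.
  by do !case: (_ \subset _); do !case: (all_bridges _); rewrite ?andbF.
apply/setP => -[F1 F2]; rewrite !inE /=; apply/negP.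
case/andP=> /andP[/and3P[_ _ /forallP c1] _].
case/andP=> /and3P[_ _ /andP[nsp _]] _.
by have /forallP/(_ p1) := c1 s; apply/negP.
Qed.

End Counting.

(** * The recurrence for the gluing of two copies *)

Lemma glue_one_point (G : special_graph) :
  one_point_gluing (@copy1 G) (@copy2 G) (spY G) (spX G).
Proof.
split; [exact: copy1_inj | exact: copy2_inj | by rewrite copy2X
       | exact: copy12_eq | case=> u]; first by left; exists u.
by right; exists (val u); rewrite /copy2 valK.
Qed.

Section GlueCounting.

Variable G : special_graph.
Hypothesis XY : spX G != spY G.
Hypothesis sG : simple_graph (edges G).
Local Notation trees G := (num_spanning_trees (edges G)).
Local Notation separating G :=
  (num_separating_forests (edges G) (spX G) (spY G)).

Let halves := edge_union (@copy1 G) (@copy2 G) (edges G) (edges G).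

Let glue_edgesE :
  edges (glue G) = [set copy1 (spX G); copy2 (spY G)] |: halves.
Proof. by rewrite /= /glue_edges -setUA. Qed.

(** The new edge joins X of the first copy to Y of the second; lying within one copy would force X
    and Y to coincide. *)
Let new_edge : [set copy1 (spX G); copy2 (spY G)] \notin halves.
Proof.
rewrite inE negb_or; apply/andP; split; apply/imsetP => -[e _].
  move/(imset_eq_set2 (@copy1_inj G)) => [u [v [_ /esym/copy12_eq[_ YX] _]]].
  by move: XY; rewrite YX eqxx.
move/(imset_eq_set2 (@copy2_inj G)) => [u [v [/copy12_eq[YX _] _ _]]].
by move: XY; rewrite YX eqxx.
Qed.

Lemma num_spanning_trees_glue :
  trees (glue G) = trees G ^ 2 + 2 * trees G * separating G.
Proof.
rewrite -mulnn glue_edgesE num_spanning_trees_setU1 ?glue_special_neq //.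
rewrite (num_spanning_trees_edge_union (glue_one_point G)) //.
rewrite (num_separating_forests_edge_union (glue_one_point G)) //.
by rewrite [separating G * _]mulnC addnn -mul2n mulnA.
Qed.

Lemma num_separating_forests_glue :
  separating (glue G) = 2 * trees G * separating G.
Proof.
rewrite glue_edgesE num_separating_forests_setU1 ?glue_special_neq //.
rewrite (num_separating_forests_edge_union (glue_one_point G)) //.
by rewrite [separating G * _]mulnC addnn -mul2n mulnA.
Qed.

End GlueCounting.

(** * Base case and closed form *)

Lemma conn_set0 (V : finType) (x y : V) : conn set0 x y = (x == y).
Proof.
apply/idP/eqP => [/connectP[[|z p] /=]|->]; [by [] | | exact: connect0].
by rewrite {1}/adj inE.
Qed.

Lemma farey0_counts :
  num_spanning_trees (edges (farey 0)) = 1 /\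
  num_separating_forests (edges (farey 0)) (spX (farey 0)) (spY (farey 0)) = 1.
Proof.
(* The single edge is added to the empty graph on two vertices, which has no spanning tree and
   exactly one separating forest. *)
have E0 : edges (farey 0) = [set false; true] |: set0 by rewrite setU0.
have b0 : all_bridges (set0 : {set {set bool}}).
  by apply/all_bridgesP => x y _; rewrite inE.
have t0 : num_spanning_trees (set0 : {set {set bool}}) = 0.
  rewrite num_spanning_treesE; apply: eq_card0 => F; rewrite !inE subset0.
  apply/negP => /andP[/eqP-> /andP[_ /forallP/(_ false)/forallP/(_ true)]].
  by rewrite conn_set0.
have s0 : num_separating_forests (set0 : {set {set bool}}) false true = 1.
  apply/eqP/cards1P; exists set0; apply/setP => F; rewrite !inE subset0.
  apply: andb_idr => /eqP->; rewrite b0 /two_components conn_set0.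
  by apply/forallP => -[]; rewrite !conn_set0.
rewrite E0; split; first by rewrite num_spanning_trees_setU1 ?inE // t0 s0.
by rewrite num_separating_forests_setU1 ?inE.
Qed.

Definition farey_product n := \prod_(2 <= i < n.+1) (2 ^ i - 1) ^ (2 ^ (n - i)).

(** The factor for [i = n.+1] has exponent 1, and every earlier exponent doubles, which squares the
    old product. *)
Lemma farey_productS n :
  farey_product n.+1 = (2 ^ n.+1 - 1) * farey_product n ^ 2.
Proof.
(* For [n = 0] both products are empty and the extra factor is [2 ^ 1 - 1 = 1]. *)
rewrite /farey_product; case: n => [|n]; first by rewrite !big_geq.
rewrite big_nat_recr //= subnn expn1 mulnC; congr (_ * _).
rewrite -[RHS]mulnn -big_split; apply: eq_big_nat => i /andP[_ i_le].
by rewrite subSn // expnS [2 * _]mulnC expnM.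
Qed.

Lemma farey_counts n :
  num_spanning_trees (edges (farey n)) = (2 ^ n.+1 - 1) * farey_product n /\
  num_separating_forests (edges (farey n)) (spX (farey n)) (spY (farey n)) =
    2 ^ n * farey_product n.
Proof.
elim: n => [|n [tn sn]].
  by have [-> ->] := farey0_counts; rewrite /farey_product big_geq.
have [XY sG] := farey_simple n.
rewrite num_spanning_trees_glue // num_separating_forests_glue // tn sn.
rewrite farey_productS; set P := farey_product n; set a := 2 ^ n.+1 - 1.
(* With this form of the coefficient, the recurrence [(a * P) ^ 2 + 2 * (a * P) * (2 ^ n * P)]
   factors as [(a + 2 * 2 ^ n) * (a * P ^ 2)]. *)
have -> : 2 ^ n.+2 - 1 = a + 2 * 2 ^ n.
  by rewrite -expnS expnS mul2n -addnn -addnBAC ?expn_gt0.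
have bE : 2 * (a * P) * (2 ^ n * P) = 2 * 2 ^ n * (a * P ^ 2).
  by rewrite -!mulnA (mulnCA P) (mulnCA a) mulnn.
split; last by rewrite bE -expnS.
by rewrite bE mulnDl expnMn -[a ^ 2]mulnn !mulnA.
Qed.

Theorem mainTheorem3 (n : nat) :
  num_spanning_trees (edges (farey n)) =
    (2 ^ n.+1 - 1) * \prod_(2 <= i < n.+1) (2 ^ i - 1) ^ (2 ^ (n - i)).
Proof. exact: (farey_counts n).1. Qed.
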